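(* Let $G=(V,E)$ be a hypergraph in which every node is contained in at least one edge. Then the complete edge relaxation $\mathrm{CER}(G)$ is an extension of the multilinear polytope $\mathrm{MP}(G)$ if and only if $G$ is an $\alpha$-acyclic hypergraph.
   Context: A hypergraph $G=(V,E)$ consists of a finite set $V$ of nodes and a set $E$ of subsets of $V$ of cardinality at least two, called edges. The multilinear polytope is $\mathrm{MP}(G):=\mathrm{conv}\{z\in\{0,1\}^{V\cup E}: z_e=\prod_{v\in e}z_v \ \forall e\in E\}$. An edge is maximal if it is not contained in any other edge of $G$; $E_{\max}$ is the set of maximal edges. Let $\mathrm{cl}(E):=\{f: |f|\ge 2,\ f\subseteq e \text{ for some } e\in E\}$. For $e\in E_{\max}$ and $U\subseteq e$ define the linear (affine) expression in $z\in\mathbb{R}^{V\cup \mathrm{cl}(E)}$ $$\psi(U,e):=\sum_{W\subseteq U,\ |W|\text{ even}} z_{(e\setminus U)\cup W}-\sum_{W\subseteq U,\ |W|\text{ odd}} z_{(e\setminus U)\cup W},$$ where $z_\emptyset:=1$ and $z_{\{v\}}:=z_v$. The complete edge relaxation is $$\mathrm{CER}(G):=\{z\in\mathbb{R}^{V\cup\mathrm{cl}(E)}: \psi(U,e)\ge 0\ \ \forall U\subseteq e,\ \forall e\in E_{\max}\}.$$ A polyhedron $Q\subseteq\mathbb{R}^{n+d}$ is an extension of a polyhedron $P\subseteq\mathbb{R}^n$ if $P=\{x\in\mathbb{R}^n:\exists y\in\mathbb{R}^d,\ (x,y)\in Q\}$. Here $\mathrm{CER}(G)$ is an extension of $\mathrm{MP}(G)$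 means that the projection of $\mathrm{CER}(G)$ onto the coordinates indexed by $V\cup E$ equals $\mathrm{MP}(G)$. $G$ is $\alpha$-acyclic if $E$ has the running intersection property: there is an ordering $f_1,\dots,f_m$ of the elements of $E$ such that for each $k=2,\dots,m$ there exists $j<k$ with $f_k\cap\bigl(\bigcup_{i<k}f_i\bigr)\subseteq f_j$. *)

(* Defs.v *)
From HB Require Import structures.
From mathcomp Require Import all_boot all_order all_algebra.
From mathcomp Require Import boolp classical_sets reals.

Set Implicit Arguments.
Unset Strict Implicit.
Unset Printing Implicit Defensive.

Import Order.TTheory GRing.Theory Num.Theory.
Local Open Scope ring_scope.

Record hypergraph (V : finType) := Hypergraph {
  edges : {set {set V}};
  edges_gt1 : forall e : {set V}, e \in edges -> (1 < #|e|)%N }.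

Section Hypergraphs.
Variable V : finType.
Implicit Types (F : {set {set V}}) (G : hypergraph V).

Definition max_edges G : {set {set V}} :=
  [set e in edges G | [forall f in edges G, (e \subset f) ==> (f == e)]]%SET.

Definition cl F : {set {set V}} :=
  [set f : {set V} | (1 < #|f|)%N && [exists e in F, f \subset e]]%SET.

Definition running_intersection (s : seq {set V}) : Prop :=
  forall k : nat, (0 < k < size s)%N ->
    exists2 j : nat, (j < k)%N &
      nth finset.set0 s k :&: \bigcup_(i < k) nth finset.set0 s i \subset nth finset.set0 s j.

Definition alpha_acyclic G : Prop :=
  exists2 s : seq {set V}, perm_eq s (enum (edges G)) & running_intersection s.

(* The index set V \cup F, as a disjoint union: the members of F are subsets
   of V, not nodes. *)
Definition coords F : finType := (V + {f : {set V} | f \in F})%type.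

Lemma sub_cl G (e : {set V}) : e \in edges G -> e \in cl (edges G).
Proof.
move=> eE; rewrite inE (edges_gt1 eE) /=.
by apply/existsP; exists e; rewrite eE subxx.
Qed.

Definition coords_incl G (i : coords (edges G)) : coords (cl (edges G)) :=
  match i with
  | inl v => inl v
  | inr e => inr (exist _ (val e) (sub_cl (valP e)))
  end.

End Hypergraphs.

Section Polytopes.
Variable R : realType.

Local Notation space I := {ffun I -> R^o}.

Definition conv (W : lmodType R) (A : set W) : set W :=
  [set x : W | exists n (p : 'I_n -> W) (a : 'I_n -> R),
    [/\ forall k, A (p k), forall k, 0 <= a k, \sum_(k < n) a k = 1
      & x = \sum_(k < n) a k *: p k]]%classic.

Definition proj (I J : finType) (h : I -> J) (z : space J) : space I :=
  [ffun i => z (h i)].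

(* R^I is viewed as a set of coordinates of R^J through h, which is meant to be
   injective; the remaining coordinates of R^J are the additional variables. *)
Definition is_extension (I J : finType) (h : I -> J)
    (Q : set (space J)) (P : set (space I)) : Prop :=
  P = (proj h @` Q)%classic.

Variable V : finType.
Implicit Types (F : {set {set V}}) (G : hypergraph V).

Definition MP G : set (space (coords (edges G))) :=
  conv [set z : space (coords (edges G)) | (forall i, z i = 0 \/ z i = 1) /\
             (forall e : {f : {set V} | f \in edges G},
                z (inr e) = \prod_(v in val e) z (inl v))]%classic.

(* z_S, with z_emptyset = 1 and z_{v} = z_v. The value 0 is a dummy, taken only
   when S has at least two elements and is not in F. *)
Definition zval F (z : space (coords F)) (S : {set V}) : R :=
  if S == finset.set0 then 1
  else if unset1 S is Some v then z (inl v)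
  else if insub S is Some f then z (inr f)
  else 0.

Definition psi F (z : space (coords F)) (U e : {set V}) : R :=
  \sum_(W : {set V} | (W \subset U) && ~~ odd #|W|) zval z ((e :\: U) :|: W)
  - \sum_(W : {set V} | (W \subset U) && odd #|W|) zval z ((e :\: U) :|: W).

Definition CER G : set (space (coords (cl (edges G)))) :=
  [set z | forall e, e \in max_edges G ->
           forall U : {set V}, U \subset e -> 0 <= psi z U e]%classic.

End Polytopes.

Arguments MP R {V} G.
Arguments CER R {V} G.

(* Main.v *)
(* A 0/1 point of V is the set A of its ones, and z_S is the mass of {A | S \subset A}
   under a probability measure. By Moebius inversion psi(U, e) is then the mass of
   {A | A :&: e = e :\: U}, so CER consists of the families z that come from a
   probability measure on each edge separately, and CER is an extension of MP iff
   every such family agrees on V and E with a single global measure (lifting).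

   If E has the running intersection property, the local measures are glued one
   edge at a time, conditionally independently given the common trace. Conversely,
   explicit locally consistent families show that lifting forces every clique of
   the adjacency graph into an edge and excludes long chordless cycles; a
   simplicial node together with its neighbours then lies in one edge, and
   removing such nodes one by one yields the ordering of the edges. *)

Require Import Defs.
From mathcomp Require Import all_boot all_order all_algebra.
From mathcomp Require Import boolp classical_sets reals.
From mathcomp Require Import lra.
(* Again, so that the names shared with classical_sets denote finite sets. *)
From mathcomp Require Import fintype finset.

Set Implicit Arguments.
Unset Strict Implicit.
Unset Printing Implicit Defensive.

Import Order.TTheory GRing.Theory Num.Theory.
Local Open Scope ring_scope.

(** * Moments of a measure on subsets *)

Section Moments.
Variables (R : realType) (V : finType).
Implicit Types (w u : {set V} -> R) (S X P Q A B : {set V}).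

Definition moment w S : R := \sum_(A : {set V} | S \subset A) w A.

Definition fibre w P X : R := \sum_(A : {set V} | A :&: P == X) w A.

Lemma moment0 w : moment w set0 = \sum_A w A.
Proof. by apply: eq_bigl => A; rewrite sub0set. Qed.

(** The sum expands a product over all nodes in which each node of [X] contributes the factor -1 +
    1. *)
Lemma sum_sign_subsets X :
  \sum_(W : {set V} | W \subset X) (-1) ^+ #|W| = (X == set0)%:R :> R.
Proof.
transitivity (\prod_i ((if i \in X then -1 else 0 : R) + 1)).
  rewrite bigA_distr big_mkcond /=; apply: eq_bigr => J _.
  rewrite -big_mkcond /=; case: ifP => [/subsetP JX|/negbT/subsetPn[x xJ xX]].
    rewrite (eq_bigr (fun=> -1)) ?prodr_const // => i iJ; by rewrite JX.
  by rewrite (bigD1 x) //= (negbTE xX) mul0r.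
have [->|/set0Pn[x xX]] := eqVneq X set0.
  by apply: big1 => i _; rewrite inE add0r.
by rewrite (bigD1 x) //= xX addNr mul0r.
Qed.

(** Inclusion-exclusion: once the sums are exchanged, a set [A] containing [X] is weighted by the
    signed count of the subsets of [(P :\: X) :&: A], which vanishes unless [A :&: P] is [X]. *)
Lemma fibre_moment w P X : X \subset P ->
  fibre w P X =
  \sum_(W : {set V} | W \subset P :\: X) (-1) ^+ #|W| * moment w (X :|: W).
Proof.
move=> XP; under [RHS]eq_bigr => W _ do rewrite mulr_sumr big_mkcond.
rewrite [RHS]exchange_big /= [LHS]big_mkcond; apply: eq_bigr => A _ /=.
rewrite -big_mkcondr /=.
have [XA|XA] := boolP (X \subset A); last first.
  rewrite big_pred0 => [|W]; last by rewrite subUset (negbTE XA) andbF.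
  by case: eqP => // AX; rewrite -AX subsetIl in XA.
transitivity (\sum_(W : {set V} | W \subset (P :\: X) :&: A) (-1) ^+ #|W| * w A).
  rewrite -mulr_suml sum_sign_subsets setIDAC setD_eq0 [P :&: A]setIC.
  rewrite eqEsubset subsetI XA XP andbT.
  by case: (A :&: P \subset X); rewrite (mul1r, mul0r).
by apply: eq_bigl => W; rewrite subsetI subUset XA.
Qed.

(** For [A] inside [P] and [g] the moments of a measure, this is the mass of the trace [A] on [P],
    by [fibre_moment]. *)
Definition mobius (g : {set V} -> R) P A : R :=
  \sum_(W : {set V} | W \subset P :\: A) (-1) ^+ #|W| * g (A :|: W).

(** Any [g] is given on [P] by the moments of a signed measure; only the signs of the Moebius values
    remain to be checked. *)
Lemma moment_mobius g P S : S \subset P ->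
  moment (fun A => if A \subset P then mobius g P A else 0) S = g S.
Proof.
move=> SP; rewrite /moment -big_mkcondr /=.
(* With [B = A :|: W], the signs are summed over all [A] between [S] and [B], so only [B = S]
   survives. *)
transitivity (\sum_(A : {set V} | (S \subset A) && (A \subset P))
   \sum_(B : {set V} | (A \subset B) && (B \subset P)) (-1) ^+ #|B :\: A| * g B).
  apply: eq_bigr => A /andP[SA AP].
  rewrite /mobius (reindex_onto (fun B => B :\: A) (fun W => A :|: W)) /=.
    apply: eq_big => [B|B /andP[_ /eqP->]] //.
    have -> : A :|: B :\: A = A :|: B by apply/setP => x; rewrite !inE; case: (x \in A).
    apply/andP/andP=> -[]; last first.
      by move=> AB BP; rewrite setSD //; split=> //; apply/eqP/setUidPr.
    move=> BA /eqP BE; split; first by rewrite -BE subsetUl.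
    apply/subsetP => x xB; have [xA|xA] := boolP (x \in A).
      exact: (subsetP AP).
    by have := subsetP BA x; rewrite !inE xA xB; apply.
  move=> W /subsetP WP; apply/setP => x; rewrite !inE.
  by have := WP x; rewrite !inE; case: (x \in A); case: (x \in W) => //= /(_ isT).
rewrite (exchange_big_dep (fun B => (S \subset B) && (B \subset P))) /=; last first.
  by move=> A B /andP[SA AP] /andP[AB BP]; rewrite (subset_trans SA AB).
transitivity (\sum_(B : {set V} | (S \subset B) && (B \subset P)) (B == S)%:R * g B).
  apply: eq_bigr => B /andP[SB BP]; rewrite -mulr_suml; congr (_ * _).
  transitivity (\sum_(W : {set V} | W \subset B :\: S) (-1) ^+ #|W| : R); last first.
    by rewrite sum_sign_subsets setD_eq0 eqEsubset SB andbT.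
  rewrite [RHS](reindex_onto (fun A => B :\: A) (fun W => B :\: W)) /=.
    apply: eq_bigl => A; rewrite BP andbT.
    have [AB|AB] := boolP (A \subset B); last first.
      rewrite andbF; apply/esym/negbTE; apply: contraNN AB => /andP[_ /eqP<-].
      exact: subsetDl.
    rewrite andbT (subset_trans AB BP) andbT setDDr setDv set0U.
    rewrite (setIidPr AB) eqxx andbT subsetD subsetDl /= disjoint_sym.
    rewrite -setI_eq0 setIDA setD_eq0.
    by rewrite (setIidPl SB).
  move=> W; rewrite subsetD => /andP[WB _].
  by rewrite setDDr setDv set0U; apply/setIidPr.
rewrite (bigD1 S) ?subxx ?SP //= eqxx mul1r big1 ?addr0 // => B /andP[_ /negbTE->].
by rewrite mul0r.
Qed.

(** The sets containing [S] but not [S'] have total mass zero. Equal moments thus become an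
    implication valid on the support of [w]. *)
Lemma moment_supp w S S' A : (forall B, 0 <= w B) -> S \subset S' ->
  moment w S = moment w S' -> w A != 0 -> S \subset A -> S' \subset A.
Proof.
move=> w0 SS' eqm wA SA; apply/negPn/negP => S'A.
have : \sum_(B : {set V} | (S \subset B) && ~~ (S' \subset B)) w B = 0.
  apply: (addrI (moment w S')); rewrite addr0 -[RHS]eqm.
  rewrite [RHS](bigID (fun B => S' \subset B)) /=; congr (_ + _).
  apply: eq_bigl => B; case: (boolP (S' \subset B)) => [S'B|]; rewrite ?andbF //.
  by rewrite (subset_trans SS' S'B).
move/psumr_eq0P => /(_ (fun B _ => w0 B) A); rewrite SA S'A => /(_ isT) wA0.
by rewrite wA0 eqxx in wA.
Qed.

Lemma moment_eq0 w S A : (forall B, 0 <= w B) ->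
  moment w S = 0 -> w A != 0 -> ~~ (S \subset A).
Proof.
move=> w0 /psumr_eq0P S0; apply: contraNN => SA; apply/eqP.
by apply: S0 => // B _.
Qed.

(** The image under [B] of the measure with weights [a]; [B] may repeat values. *)
Definition atoms (I : finType) (a : I -> R) (B : I -> {set V}) A : R :=
  \sum_(i | B i == A) a i.

Lemma atoms_ge0 (I : finType) (a : I -> R) (B : I -> {set V}) A :
  (forall i, 0 <= a i) -> 0 <= atoms a B A.
Proof. by move=> a0; apply: sumr_ge0. Qed.

Lemma moment_atoms (I : finType) (a : I -> R) (B : I -> {set V}) S :
  moment (atoms a B) S = \sum_(i | S \subset B i) a i.
Proof.
rewrite [RHS](partition_big B (fun A => S \subset A)) //=.
apply: eq_bigr => A SA; apply: eq_bigl => i.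
by case: eqP => [->|]; rewrite ?SA // andbF.
Qed.

(* The two measures are made conditionally independent given the trace on
   [P :&: Q]; a fibre of mass zero only carries zero weights, so the junk value
   of the division by zero is harmless. *)
Lemma glue w u P Q : (forall A, 0 <= w A) -> (forall A, 0 <= u A) ->
  (forall S, S \subset P :&: Q -> moment w S = moment u S) ->
  exists t, [/\ forall A, 0 <= t A,
    forall S, S \subset P -> moment t S = moment w S &
    forall S, S \subset Q -> moment t S = moment u S].
Proof.
move=> w0 u0 wu; set I := P :&: Q.
have fwu X : X \subset I -> fibre w I X = fibre u I X.
  move=> XI; rewrite !fibre_moment //; apply: eq_bigr => W WI; rewrite wu //.
  by rewrite subUset XI (subset_trans WI) // subsetDl.
pose a (AB : {set V} * {set V}) : R :=
  if AB.1 :&: I == AB.2 :&: I then w AB.1 * u AB.2 / fibre w I (AB.1 :&: I)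
  else 0.
(* When both sets agree on [I], this union has the trace of the first on [P] and that of the second
   on [Q]. *)
pose D (AB : {set V} * {set V}) := (AB.1 :&: P) :|: (AB.2 :&: Q).
have aE (S : {set V}) (p : {set V} -> {set V} -> bool) :
    (forall A B, A :&: I = B :&: I -> (S \subset D (A, B)) = p A B) ->
    moment (atoms a D) S = \sum_A \sum_(B : {set V} | p A B) a (A, B).
  move=> pP; rewrite moment_atoms pair_big_dep big_mkcond [RHS]big_mkcond /=.
  apply: eq_bigr => -[A B] _ /=; rewrite /a /=.
  case: eqP => [AB|_]; last by case: ifP; case: ifP.
  by rewrite pP.
exists (atoms a D); split=> [A|S SP|S SQ].
- apply: atoms_ge0 => -[B C]; rewrite /a /=; case: ifP => // _.
  by rewrite divr_ge0 ?mulr_ge0 ?sumr_ge0.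
- rewrite (aE _ (fun A _ => S \subset A)).
    rewrite [RHS]big_mkcond /=; apply: eq_bigr => A _.
    case: (boolP (S \subset A)) => SA; last by rewrite big_pred0.
    have -> : \sum_B a (A, B) =
        w A / fibre w I (A :&: I) * fibre u I (A :&: I).
      rewrite /fibre mulr_sumr [RHS]big_mkcond; apply: eq_bigr => B _.
      by rewrite /a /= [B :&: I == _]eq_sym; case: ifP => // _; rewrite mulrAC.
    rewrite -fwu ?subsetIr //.
    have [/psumr_eq0P f0|fN0] := eqVneq (fibre w I (A :&: I)) 0.
      by rewrite f0 ?mul0r.
    by rewrite divfK.
  move=> A B AB; rewrite /D /=; apply/subsetP/subsetP => SA x xS;
    have xP := subsetP SP x xS.
    have /setP/(_ x) := AB; have := SA x xS; rewrite !inE xP.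
    by case: (x \in A); case: (x \in B); case: (x \in Q).
  by rewrite !inE xP SA.
- rewrite (aE _ (fun _ B => S \subset B)).
    rewrite (exchange_big_dep (fun B => S \subset B)) //=.
    apply: eq_bigr => A SA; rewrite (eq_bigl xpredT) => [|B]; last by rewrite SA.
    have -> : \sum_B a (B, A) =
        u A / fibre w I (A :&: I) * fibre w I (A :&: I).
      rewrite /fibre mulr_sumr [RHS]big_mkcond; apply: eq_bigr => B _.
      by rewrite /a /=; case: eqP => // ->; rewrite [w B * _]mulrC mulrAC.
    have [|fN0] := eqVneq (fibre w I (A :&: I)) 0; last by rewrite divfK.
    rewrite fwu ?subsetIr // => /psumr_eq0P f0.
    by rewrite f0 ?mul0r.
  move=> A B AB; rewrite /D /=; apply/subsetP/subsetP => SA x xS;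
    have xQ := subsetP SQ x xS.
    have /setP/(_ x) := AB; have := SA x xS; rewrite !inE xQ.
    by case: (x \in A); case: (x \in B); case: (x \in P).
  by rewrite !inE xQ SA // !andbT orbT.
Qed.

End Moments.

(** * Running intersection orderings *)

Section Acyclicity.
Local Open Scope nat_scope.
Variable V : finType.
Implicit Types (s t : seq {set V}) (F : {set {set V}}) (C D W e f g h : {set V}).

(* The running intersection property read from the last edge backwards. *)
Fixpoint rip s : bool :=
  if s is f :: s' then
    ((s' == [::]) || has (fun h => f :&: \bigcup_(g <- s') g \subset h) s')
    && rip s'
  else true.

Lemma running_intersection_rcons s f :
  running_intersection (rcons s f) <->
  running_intersection s /\
  ((s == [::]) || has (fun h => f :&: \bigcup_(g <- s) g \subset h) s).
Proof.
have nthl k : k < size s -> nth set0 (rcons s f) k = nth set0 s k.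
  by move=> ks; rewrite nth_rcons ks.
have cupl k : k <= size s ->
    \bigcup_(i < k) nth set0 (rcons s f) i = \bigcup_(i < k) nth set0 s i.
  by move=> ks; apply: eq_bigr => i _; rewrite nthl // (leq_trans (ltn_ord i)).
have cups : \bigcup_(i < size s) nth set0 s i = \bigcup_(g <- s) g.
  by rewrite [RHS](big_nth set0) big_mkord.
have lastf : nth set0 (rcons s f) (size s) = f by rewrite nth_rcons ltnn eqxx.
split=> [H|[H1 H2] k]; first split.
- move=> k /andP[k0 ks].
  have [|j jk] := H k; first by rewrite size_rcons k0 ltnS ltnW.
  rewrite cupl; last exact: ltnW.
  rewrite !nthl //; last exact: ltn_trans ks.
  by move=> sub; exists j.
- have [//|sN] := eqVneq s [::].
  have [|j js] := H (size s).
    by rewrite size_rcons ltnSn andbT; case: (s) sN.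
  rewrite lastf cupl // cups nthl // => sub.
  by apply/hasP; exists (nth set0 s j); rewrite ?mem_nth.
- rewrite size_rcons ltnS => /andP[k0]; rewrite leq_eqVlt => /orP[/eqP kE|ks].
    rewrite kE; case/orP: H2 => [/eqP s0|/hasP[h /(nthP set0)[j js <-] sub]].
      by rewrite kE s0 in k0.
    by exists j => //; rewrite lastf cupl // cups nthl.
  have [|j jk sub] := H1 k; first by rewrite k0.
  exists j => //; rewrite cupl; last exact: ltnW.
  by rewrite !nthl //; apply: ltn_trans ks.
Qed.

Lemma rip_rev s : running_intersection s <-> rip (rev s).
Proof.
elim/last_ind: s => [|s f IH]; first by split=> // _ k; rewrite andbF.
rewrite running_intersection_rcons rev_rcons /= IH.
have -> : (rev s == [::]) = (s == [::]) by rewrite -!size_eq0 size_rev.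
have -> : \bigcup_(g <- rev s) g = \bigcup_(g <- s) g.
  by apply: perm_big; rewrite perm_rev.
by rewrite has_rev; split=> [[-> ->]|/andP[-> ->]].
Qed.

(** An edge contained in a later entry [h] meets anything within [h]. *)
Lemma rip_cat t s : rip s -> (forall f, f \in t -> exists2 h, h \in s & f \subset h) ->
  rip (t ++ s).
Proof.
move=> rs; elim: t => //= f t IH sub; rewrite IH ?andbT; last first.
  by move=> g gt; apply: sub; rewrite inE gt orbT.
have [|h hs fh] := sub f; first by rewrite inE eqxx.
apply/orP; right; apply/hasP; exists h; first by rewrite mem_cat hs orbT.
by rewrite (subset_trans (subsetIl _ _)).
Qed.

Lemma mem_bigcup_seq s (x : V) :
  reflect (exists2 g, g \in s & x \in g) (x \in \bigcup_(g <- s) g).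
Proof.
elim: s => [|g s IH].
  by rewrite big_nil inE; constructor => -[].
rewrite big_cons inE; apply: (iffP orP) => [[xg|/IH[h hs xh]]|[h]].
- by exists g; rewrite ?inE ?eqxx.
- by exists h; rewrite // inE hs orbT.
by rewrite inE => /orP[/eqP->|hs xh]; [left | right; apply/IH; exists h].
Qed.

(** Afterwards [v] lies in at most one entry, so the intersections of entries with later unions are
    unchanged, while the witnesses can only grow. *)
Lemma rip_extend s (g : {set V}) (v : V) :
  rip s -> uniq s -> (forall h, h \in s -> v \notin h) ->
  rip [seq if h == g then v |: g else h | h <- s].
Proof.
elim: s => //= f s IH /andP[fs rs] /andP[fNs us] vN.
have vNs h : h \in s -> v \notin h by move=> hs; rewrite vN // inE hs orbT.
rewrite IH // andbT; case/orP: fs => [/eqP->//|/hasP[k ks sub]].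
apply/orP; right; apply/hasP.
exists (if k == g then v |: g else k); first exact: map_f.
have kext : k \subset (if k == g then v |: g else k).
  by case: eqP => [->|//]; rewrite subsetUr.
apply: subset_trans kext; apply: subset_trans sub.
apply/subsetP => x; rewrite inE => /andP[xf /mem_bigcup_seq[_ /mapP[h hs ->] xh]].
have [fg|fg] := eqVneq f g.
  rewrite -fg in xf xh; case: eqP xh => [hf|_ xh]; first by rewrite hf (negbTE fNs) in hs.
  rewrite inE; apply/andP; split; last by apply/mem_bigcup_seq; exists h.
  move: xf; rewrite eqxx in_setU1 => /orP[/eqP xv|//].
  by have := vNs h hs; rewrite -xv xh.
move: xf; rewrite (negbTE fg) => xf.
rewrite inE xf; apply/mem_bigcup_seq; exists h => //.
case: eqP xh => [-> |//]; rewrite in_setU1 => /orP[/eqP xv|//].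
by have := vN f; rewrite inE eqxx -xv xf => /(_ isT).
Qed.

(** * Chordality, conformality and simplicial nodes of the adjacency graph *)

Definition adj F (u v : V) := [exists f in F, (u \in f) && (v \in f)].

Lemma adjP F u v : reflect (exists f, [/\ f \in F, u \in f & v \in f]) (adj F u v).
Proof.
apply: (iffP existsP) => [[f /and3P[fF uf vf]]|[f [fF uf vf]]]; exists f => //.
by rewrite fF uf.
Qed.

Lemma adjC F u v : adj F u v = adj F v u.
Proof. by apply: eq_existsb => f; rewrite [(u \in f) && _]andbC. Qed.

(** Reachability from [x] inside [C], stated as an induction principle to avoid paths. *)
Definition connected_from F (x : V) C : Prop := x \in C /\
  forall A : {set V}, x \in A ->
    (forall a c, a \in A -> a \in C -> c \in C -> adj F a c -> c \in A) ->
    C \subset A.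

Definition covers F : Prop := forall v : V, exists2 e, e \in F & v \in e.

(* Equivalent to chordality of the graph [adj F]: a chordless cycle through d
   leaves a connected set C after deletion of d and its two neighbours y, z. *)
Definition chordal F : Prop := forall C (x y z d : V), connected_from F x C ->
  (exists2 c, c \in C & adj F c y) -> (exists2 c, c \in C & adj F c z) ->
  (forall c, c \in C -> ~~ adj F c d) -> adj F y d -> adj F z d -> adj F y z.

Definition conformal F : Prop := forall K : {set V}, K != set0 ->
  {in K &, forall u v, adj F u v} -> exists2 e, e \in F & K \subset e.

Definition simplicial F W (v : V) : Prop := v \in W /\
  {in W &, forall u u', adj F v u -> adj F v u' -> adj F u u'}.

(* Take C connected and maximal among those not dominating W. By maximality
   every neighbour of C is adjacent to the whole set D of undominated nodes, and
   by chordality these neighbours form a clique, so that a simplicial node of D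
   is simplicial in W. *)
Lemma ex_simplicial F W : covers F -> chordal F -> W != set0 ->
  exists v, simplicial F W v.
Proof.
move=> cov cho; have [n] := ubnP #|W|; elim: n W => // n IH W Wn WN0.
have adjxx v : adj F v v by have [e eF ve] := cov v; apply/adjP; exists e.
have [full|] := boolP [forall u in W, [forall v in W, adj F u v]].
  have [v vW] := set0Pn _ WN0; exists v; split=> // u u' uW u'W _ _.
  by move/forall_inP: full => /(_ u uW)/forall_inP/(_ u' u'W).
case/forall_inPn => x xW /forall_inPn[d0 d0W xd0].
pose ok C := [&& C \subset W, `[< connected_from F x C >] &
  [exists d in W, [forall c in C, ~~ adj F c d]]].
have okx : ok [set x].
  rewrite /ok sub1set xW /=; apply/andP; split.
    by apply/asboolP; split; [rewrite inE | move=> A xA _; rewrite sub1set].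
  by apply/exists_inP; exists d0 => //; apply/forall_inP => c /set1P->.
have [C Cmax _] := @maxset_exists _ ok _ okx.
have /and3P[CW /asboolP[xC conC] /exists_inP[d1 d1W /forall_inP d1C]] :=
  maxsetp Cmax.
pose D := [set d in W | [forall c in C, ~~ adj F c d]].
have DP d : d \in D -> forall c, c \in C -> ~~ adj F c d.
  by rewrite inE => /andP[_ /forall_inP].
have DN0 : D != set0.
  by apply/set0Pn; exists d1; rewrite inE d1W; apply/forall_inP.
have DW : D \proper W.
  apply/properP; split; first by apply/subsetP => d; rewrite inE => /andP[].
  by exists x => //; apply/negP => /DP/(_ x xC); rewrite adjxx.
have [v [vD vS]] := IH D (leq_trans (proper_card DW) Wn) DN0.
have domP u : u \in W -> u \notin D -> exists2 c, c \in C & adj F c u.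
  by move=> uW; rewrite inE uW => /forall_inPn[c cC]; rewrite negbK; exists c.
(* Otherwise [u |: C] would be connected and still leave [d] undominated, against maximality. *)
have domD u d : u \in W -> u \notin D -> u \notin C -> d \in D -> adj F u d.
  move=> uW uD uC dD; apply: contraNT uC => ud.
  have [c0 c0C c0u] := domP u uW uD.
  suff <- : u |: C = C by rewrite setU11.
  apply: (maxsetsup Cmax); last exact: subsetUr.
  apply/and3P; split; first by rewrite subUset sub1set uW.
    apply/asboolP; split; first by rewrite inE xC orbT.
    move=> A xA clA.
    have CA : C \subset A.
      by apply: conC => // a c aA aC cC; apply: clA; rewrite // inE ?aC ?cC orbT.
    rewrite subUset CA andbT sub1set.
    apply: (clA c0) => //; last exact: setU11.
      exact: (subsetP CA).
    by rewrite inE c0C orbT.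
  apply/exists_inP; exists d; first by move: dD; rewrite inE => /andP[].
  by apply/forall_inP => c /setU1P[->//|]; apply: DP.
have vW : v \in W by apply: (subsetP (proper_sub DW)).
have notC u : adj F v u -> u \notin C.
  by apply: contraTN => uC; rewrite adjC; apply: DP.
exists v; split=> // u u' uW u'W vu vu'.
have [uD|uD] := boolP (u \in D); have [u'D|u'D] := boolP (u' \in D).
- exact: vS.
- by rewrite adjC; apply: domD => //; apply: notC.
- by apply: domD => //; apply: notC.
- apply: (cho C x u u' v) => //; try exact: domP; try by rewrite adjC.
  by move=> c cC; apply: DP.
Qed.

(* Remove a simplicial node v, whose neighbourhood lies in an edge e. Since s is
   an antichain, the trace of e on W :\ v is either a member of s, to which v is
   put back, or properly inside one, and then no other trace has lost v. *)
Lemma rip_trace F W : covers F -> chordal F -> conformal F ->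
  exists s, [/\ rip s, uniq s, {in s &, forall g h, g \subset h -> g = h},
    forall g, g \in s -> exists2 f, f \in F & g = f :&: W &
    forall f, f \in F -> exists2 g, g \in s & f :&: W \subset g].
Proof.
move=> cov cho conf; have [n] := ubnP #|W|; elim: n W => // n IH W Wn.
have [->|WN0] := eqVneq W set0.
  have [->|/set0Pn[f0 f0F]] := eqVneq F set0.
    by exists [::]; split=> // f; rewrite inE.
  exists [:: set0]; split=> //.
  - by move=> g h; rewrite !inE => /eqP-> /eqP->.
  - by move=> g; rewrite inE => /eqP->; exists f0; rewrite ?setI0.
  - by move=> f _; exists set0; rewrite ?inE // setI0.
have adjxx v : adj F v v by have [e eF ve] := cov v; apply/adjP; exists e.
have [v [vW vS]] := ex_simplicial cov cho WN0.
pose N := [set u in W | adj F v u].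
have vN : v \in N by rewrite inE vW adjxx.
have [| |e eF Ne] := conf N; first by apply/set0Pn; exists v.
  move=> u u'; rewrite !inE => /andP[uW vu] /andP[u'W vu'].
  exact: vS.
have ve : v \in e by apply: (subsetP Ne).
(* In [W], an edge through [v] contains only neighbours of [v], all of which lie in [e]. *)
have fe f : f \in F -> v \in f -> f :&: W \subset e :&: W.
  move=> fF vf; rewrite subsetI subsetIr andbT; apply/subsetP => u.
  rewrite inE => /andP[uf uW]; apply: (subsetP Ne); rewrite inE uW.
  by apply/adjP; exists f.
set W' := W :\ v.
have W'W : W' \subset W by apply: subsetDl.
have fW' f : v \notin f -> f :&: W' = f :&: W.
  move=> vf; rewrite /W' setIDA; apply/setDidPl.
  by rewrite disjoint_sym disjoints1 inE (negbTE vf).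
have [|s [rs us anti tr cs]] := IH W'.
  by move: Wn; rewrite [#|W|](cardsD1 v) vW.
have [g0 g0s eg0] := cs e eF.
have vNs g : g \in s -> v \notin g.
  by move=> /tr[f _ ->]; rewrite !inE eqxx andbF.
(* An entry coming from an edge through [v] lies in [e :&: W'], hence in [g0]; the antichain
   property makes all three equal. *)
have tr' g : g \in s -> g = e :&: W' \/ exists2 f, f \in F & g = f :&: W.
  move=> gs; have [f fF gE] := tr g gs.
  have [vf|vf] := boolP (v \in f); last by right; exists f; rewrite -?fW'.
  left; have ge : g \subset e :&: W'.
    rewrite gE subsetI subsetIr andbT.
    apply: subset_trans (subsetIl e W); apply: subset_trans (fe f fF vf).
    exact: setIS.
  have gg0 : g = g0 by apply: anti => //; apply: subset_trans eg0.
  by apply/eqP; rewrite eqEsubset ge gg0.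
have cs' f : f \in F -> v \notin f -> exists2 g, g \in s & f :&: W \subset g.
  by move=> fF vf; rewrite -fW' //; apply: cs.
have eW : e :&: W = v |: (e :&: W').
  apply/setP => u; rewrite !inE; have [->|] := eqVneq u v => //=.
  by rewrite ve vW.
have veW : v \in e :&: W by rewrite inE ve.
have [g0E|g0E] := eqVneq g0 (e :&: W').
  pose E := v |: g0.
  have EE : E = e :&: W by rewrite eW -g0E.
  pose ext h := if h == g0 then E else h.
  have extN h : h \in s -> h != g0 -> ~~ (E \subset h) && ~~ (h \subset E).
    move=> hs hg; apply/andP; split.
      apply/negP => /subsetP/(_ v); rewrite setU11 => /(_ isT).
      by rewrite (negbTE (vNs h hs)).
    apply: contraNN hg => hE; apply/eqP; apply: anti => //.
    apply/subsetP => u uh; have := subsetP hE u uh; rewrite in_setU1.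
    by case/orP=> // /eqP uv; have := vNs h hs; rewrite -uv uh.
  have extI : {in s &, forall g h, ext g \subset ext h -> g = h}.
    move=> g h gs hs; rewrite /ext.
    case: (eqVneq g g0) => [->|gg]; case: (eqVneq h g0) => [->|hg] //.
    - by have /andP[/negbTE-> _] := extN h hs hg.
    - by have /andP[_ /negbTE->] := extN g gs gg.
    - exact: anti.
  exists [seq ext h | h <- s]; split.
  - exact: rip_extend.
  - rewrite map_inj_in_uniq // => g h gs hs gh.
    by apply: extI; rewrite // gh.
  - by move=> _ _ /mapP[g gs ->] /mapP[h hs ->] /extI->.
  - move=> _ /mapP[g gs ->]; rewrite /ext.
    case: eqP => [_|/eqP gg]; first by exists e.
    by case: (tr' g gs) => // gE; rewrite gE -g0E eqxx in gg.
  - move=> f fF; have [vf|vf] := boolP (v \in f).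
      exists E; last by rewrite EE fe.
      by apply/mapP; exists g0; rewrite // /ext eqxx.
    have [g gs fg] := cs' f fF vf; exists (ext g); first exact: map_f.
    by rewrite /ext; case: eqP fg => // -> /subset_trans; apply; apply: subsetUr.
have tr2 g : g \in s -> exists2 f, f \in F & g = f :&: W.
  move=> gs; case: (tr' g gs) => // gE.
  case/eqP: g0E; rewrite -gE; apply/esym/anti => //.
  by rewrite gE.
have eNs g : g \in s -> ~~ (e :&: W \subset g).
  by move=> gs; apply/negP => /subsetP/(_ v veW); rewrite (negbTE (vNs g gs)).
have Nse g : g \in s -> ~~ (g \subset e :&: W).
  move=> gs; apply: contra_neqN g0E => ge.
  have ge' : g \subset e :&: W'.
    apply/subsetP => u ug; have := subsetP ge u ug; rewrite eW in_setU1.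
    by case/orP=> // /eqP uv; have := vNs g gs; rewrite -uv ug.
  have gg0 : g = g0 by apply: anti => //; apply: subset_trans eg0.
  by apply/eqP; rewrite eqEsubset eg0 -gg0 ge'.
(* No entry of [s] contains [v], so [e :&: W] meets them only inside [e :&: W'], which [g0]
   contains. *)
exists (e :&: W :: s); split.
- rewrite /= rs andbT; apply/orP; right; apply/hasP; exists g0 => //.
  apply: subset_trans eg0; apply/subsetP => u; rewrite inE => /andP[ueW].
  case/mem_bigcup_seq => g gs ug; move: ueW; rewrite eW in_setU1.
  by case/orP=> // /eqP uv; have := vNs g gs; rewrite -uv ug.
- by rewrite /= us andbT; apply/negP => /eNs; rewrite subxx.
- move=> g h; rewrite !inE => /orP[/eqP->|gs] /orP[/eqP->|hs] //.
  + by rewrite (negbTE (eNs h hs)).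
  + by rewrite (negbTE (Nse g gs)).
  + exact: anti.
- by move=> g; rewrite inE => /orP[/eqP->|/tr2//]; exists e.
- move=> f fF; have [vf|vf] := boolP (v \in f).
    by exists (e :&: W); [rewrite inE eqxx | apply: fe].
  by have [g gs fg] := cs' f fF vf; exists g; rewrite // inE gs orbT.
Qed.

(** On the whole node set, [rip_trace] orders the maximal edges; the other edges, each inside one of
    these, come last in the ordering. *)
Lemma chordal_conformal_rip F : covers F -> chordal F -> conformal F ->
  exists2 s, perm_eq s (enum F) & running_intersection s.
Proof.
move=> cov cho conf; have [s [rs us _ sF Fs]] := rip_trace setT cov cho conf.
have {}sF : {subset s <= F} by move=> g /sF[f fF ->]; rewrite setIT.
pose t := [seq f <- enum F | f \notin s].
exists (rev (t ++ s)); last first.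
  apply/rip_rev; rewrite revK; apply: rip_cat => // f.
  rewrite mem_filter mem_enum => /andP[_ fF].
  by have [g gs] := Fs f fF; rewrite setIT; exists g.
rewrite perm_rev; apply: uniq_perm; last 1 first.
- move=> f; rewrite mem_cat mem_filter !mem_enum.
  by case: (boolP (f \in s)) => [/sF->|_] //=; rewrite orbF.
- rewrite cat_uniq filter_uniq ?enum_uniq // us andbT.
  by apply/hasPn => f fs; rewrite mem_filter fs.
- exact: enum_uniq.
Qed.

End Acyclicity.

(** * From local to global measures *)

Section Lifting.
Variables (R : realType) (V : finType).
Implicit Types (F : {set {set V}}) (g : {set V} -> R) (e A S : {set V}).

(** The extension property without coordinates: [g S] stands for z_S, and the global measure must
    match [g] only on the nodes and edges, which the projection keeps. *)
Definition lifting F : Prop := forall g, g set0 = 1 ->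
  (forall e, e \in F -> exists w : {set V} -> R, (forall A, 0 <= w A) /\
     forall S, S \subset e -> g S = moment w S) ->
  exists w : {set V} -> R, [/\ forall A, 0 <= w A, moment w set0 = 1,
    forall v, g [set v] = moment w [set v] &
    forall e, e \in F -> g e = moment w e].

(** A new edge meets the union of the previous ones inside a single edge, where both measures have
    the moments [g]; hence [glue] applies. *)
Lemma rip_lifting F (s : seq {set V}) : covers F -> perm_eq s (enum F) ->
  running_intersection s -> lifting F.
Proof.
move=> cov sF /rip_rev rs g g0 loc.
suff [w [w0 w1 wg]] : exists w : {set V} -> R, [/\ forall A, 0 <= w A,
    moment w set0 = 1 &
    forall e, e \in rev s -> forall S, S \subset e -> g S = moment w S].
  have eF e : e \in F -> e \in rev s.
    by rewrite mem_rev (perm_mem sF) mem_enum.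
  exists w; split=> // [v|e /eF es]; last exact: (wg e).
  by have [e /eF es ve] := cov v; apply: (wg e); rewrite ?sub1set.
have {sF}: forall e, e \in rev s -> e \in F.
  by move=> e; rewrite mem_rev (perm_mem sF) mem_enum.
elim: (rev s) rs => [_ _|f t IH /= /andP[ft rt] sub].
  exists (atoms (fun _ : unit => 1) (fun=> set0)); split=> //.
    by move=> A; apply: atoms_ge0 => _; apply: ler01.
  by rewrite moment_atoms sub0set (big_pred1 tt) // => -[].
have [|w [w0 w1 wg]] := IH rt.
  by move=> e et; apply: sub; rewrite inE et orbT.
have [|u [u0 ug]] := loc f; first by rewrite sub // inE eqxx.
have [S|v [v0 vw vu]] := @glue _ _ w u (\bigcup_(h <- t) h) f w0 u0.
  rewrite setIC => SI; rewrite -ug ?(subset_trans SI) ?subsetIl //.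
  case/orP: ft => [/eqP t0|/hasP[h ht hS]]; last first.
    by rewrite (wg h) // (subset_trans SI).
  move: SI; rewrite t0 big_nil setI0 subset0 => /eqP->.
  by rewrite w1 g0.
exists v; split=> //; first by rewrite vw ?sub0set.
move=> e; rewrite inE => /orP[/eqP->|et] S Se.
  by rewrite vu // ug.
rewrite vw; first exact: (wg e).
by apply/subsetP => x xS; apply/mem_bigcup_seq; exists e; rewrite // (subsetP Se).
Qed.

(* A minimal clique K lying in no edge would be excluded by the point whose trace
   on an edge through K :\ v0 puts mass 1/(#|K|-1) on each of the sets omitting
   one node of K :\ v0: a global measure omits #|K|/(#|K|-1) < 2 nodes of K on
   average, but at least two nodes almost surely. *)
Lemma lifting_conformal F : covers F -> lifting F -> conformal F.
Proof.
move=> cov lift K; have [n] := ubnP #|K|; elim: n K => // n IH K Kn KN0 clK.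
have [k2|k3] := leqP #|K| 2.
  have [u uK] := set0Pn _ KN0.
  have [K1|] := boolP (K :\ u == set0).
    have [e eF ue] := cov u; exists e => //.
    by rewrite -(setD1K uK) (eqP K1) setU0 sub1set.
  case/set0Pn => v vK; have vK' : v \in K by move: vK; rewrite inE => /andP[].
  have /adjP[e [eF ue ve]] := clK u v uK vK'; exists e => //.
  rewrite -(setD1K uK) -(setD1K vK) !subUset !sub1set ue ve /=.
  suff /eqP-> : K :\ u :\ v == set0 by rewrite sub0set.
  rewrite -cards_eq0 -leqn0; move: k2; rewrite (cardsD1 u) uK (cardsD1 v) vK.
  by rewrite !add1n !ltnS.
have [/exists_inP[e eF Ke]|/exists_inPn noe] := boolP [exists e in F, K \subset e].
  by exists e.
exfalso; set k := #|K|.-1.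
have Kk : #|K| = k.+1 by rewrite /k prednK // (leq_trans _ k3).
have k1 : (1 < k)%N by rewrite -ltnS -Kk.
have kR : (1 : R) < k%:R by rewrite ltr1n.
have k0 : k%:R != 0 :> R by rewrite gt_eqF // (lt_trans ltr01).
have KDk v : v \in K -> #|K :\ v| = k by move=> vK; rewrite /k [#|K|](cardsD1 v) vK.
have eP v : v \in K -> exists e, [/\ e \in F, K :\ v \subset e & v \notin e].
  move=> vK; have [|||e eF Kve] := IH (K :\ v).
  - by rewrite KDk // -ltnS -Kk.
  - by rewrite -card_gt0 KDk // (ltn_trans _ k1).
  - by move=> x y /setD1P[_ xK] /setD1P[_ yK]; apply: clK.
  exists e; split=> //; apply: contraNN (noe e eF) => ve.
  by rewrite -(setD1K vK) subUset sub1set ve.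
(* Each edge misses some [v0] of [K]; there [g] comes from omitting a uniformly chosen node of
   [K :\ v0], and the formula does not depend on [v0]. *)
pose g S : R := 1 - #|S :&: K|%:R / k%:R.
have [||w [w0 w1 wv we]] := lift g.
- by rewrite /g set0I cards0 mul0r subr0.
- move=> e eF; have /subsetPn[v0 v0K v0e] := noe e eF.
  exists (atoms (fun v => if v \in K :\ v0 then k%:R^-1 else 0)
                (fun v => [set~ v])).
  split=> [A|S Se]; first by apply: atoms_ge0 => v; case: ifP; rewrite ?invr_ge0.
  rewrite moment_atoms -big_mkcondr /=.
  rewrite (eq_bigl (fun v => v \in (K :\ v0) :\: S)); last first.
    by move=> v; rewrite -disjoints_subset disjoint_sym disjoints1 [RHS]in_setD.
  rewrite sumr_const -[_ *+ _]mulr_natl /g.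
  have SK : S :&: K = (K :\ v0) :&: S.
    apply/setP => x; rewrite !inE; have [->|_] := eqVneq x v0.
      by rewrite (contraNF (subsetP Se v0) v0e).
    by rewrite andbC.
  have := cardsID S (K :\ v0); rewrite -SK KDk // => /(congr1 (fun m => m%:R : R)).
  rewrite natrD => kE; apply: (mulIf k0).
  by rewrite mulrBl mul1r !divfK //; lra.
have out u A : u \notin K -> w A != 0 -> u \in A.
  move=> uK wA; rewrite -sub1set; apply: (moment_supp w0 (sub0set _)) (sub0set _) => //.
  rewrite w1 -wv /g (_ : _ :&: K = set0) ?cards0 ?mul0r ?subr0 //.
  by apply/setP => x; rewrite !inE; case: eqP => // ->; apply/negbTE.
(* A set omitting at most the node [v] of [K] would contain the edge through [K :\ v] given by [eP],
   whose moment is 1 - k/k = 0. *)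
have card2 A : w A != 0 -> (2 <= #|K :\: A|)%N.
  move=> wA; rewrite leqNgt; apply/negP; rewrite ltnS => card1.
  have [v vK KAv] : exists2 v, v \in K & K :\: A \subset [set v].
    have [KA0|/set0Pn[v vKA]] := eqVneq (K :\: A) set0.
      by have [v vK] := set0Pn _ KN0; exists v; rewrite // KA0 sub0set.
    exists v; first by move: vKA; rewrite inE => /andP[].
    by rewrite subset1; apply/orP; left; rewrite eq_sym eqEcard sub1set vKA cards1.
  have [e [eF Ke ve]] := eP v vK.
  have : moment w e = 0.
    rewrite -we // /g (_ : e :&: K = K :\ v) ?KDk ?divff ?subrr //.
    apply/eqP; rewrite eqEsubset subsetI Ke subsetDl andbT subsetD1 subsetIr.
    by rewrite inE (negbTE ve).
  move/(moment_eq0 w0)/(_ wA)/negP; apply; apply/subsetP => u ue.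
  have [uK|] := boolP (u \in K); last by move/out; apply.
  apply: contraTT ue => uA; have := subsetP KAv u; rewrite !inE uA uK.
  by move=> /(_ isT)/eqP->.
(* Double counting: each node of [K] is omitted with probability 1/k. *)
have sumE : \sum_A w A * #|K :\: A|%:R = #|K|%:R / k%:R.
  transitivity (\sum_(v in K) \sum_(A : {set V} | v \notin A) w A).
    rewrite (exchange_big_dep predT) //=; apply: eq_bigr => A _.
    rewrite mulr_natr -sumr_const; apply: eq_bigl => v.
    by rewrite inE andbC.
  rewrite mulr_natl -sumr_const; apply: eq_bigr => v vK.
  have m1 : moment w [set v] = 1 - k%:R^-1.
    rewrite -wv /g (_ : [set v] :&: K = [set v]) ?cards1 ?mul1r //.
    by apply/setIidPl; rewrite sub1set.
  apply: (addrI (moment w [set v])); rewrite [in RHS]m1 subrK -w1 moment0.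
  rewrite [RHS](bigID (fun A : {set V} => v \in A)) /=; congr (_ + _).
  by apply: eq_bigl => A; rewrite sub1set.
have : 2 <= \sum_A w A * #|K :\: A|%:R.
  have -> : 2 = \sum_A w A * 2 by rewrite -mulr_suml -moment0 w1 mul1r.
  apply: ler_sum => A _.
  have [->|wA] := eqVneq (w A) 0; first by rewrite !mul0r.
  by rewrite ler_wpM2l // ler_nat card2.
rewrite sumE ler_pdivlMr ?(lt_trans ltr01) // Kk -natr1.
by lra.
Qed.

(* If y and z were not adjacent, consider a fair coin shared by C, y and z, equal
   to d on the edges through y and d, opposite to d on those through z and d. *)
Lemma lifting_chordal F : lifting F -> chordal F.
Proof.
move=> lift C x y z d [xC conC] [cy cyC acy] [cz czC acz] Cd yd zd.
apply: contraT => yz; exfalso.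
have zNd : z != d by apply: contraNneq yz => ->.
pose T := C :|: [set y; z; d].
have zT : z \in T by rewrite !inE eqxx !orbT.
have dT : d \in T by rewrite !inE eqxx !orbT.
have yT : y \in T by rewrite !inE eqxx !orbT.
have CT c : c \in C -> c \in T by rewrite !inE => ->.
(* Nodes of [C] are not adjacent to [d], nor is [y] to [z], so on such an edge the opposite values
   of [z] and [d] constrain no other node of [T]. *)
have eT e u : e \in F -> z \in e -> d \in e -> u \in e -> u \in T ->
    (u == z) || (u == d).
  move=> eF ze de ue; rewrite !inE -!orbA => /or4P[uC|/eqP uy|->|->]; rewrite ?orbT //.
    by case/adjP: (Cd u uC); exists e.
  by case/adjP: yz; exists e; rewrite -uy.
pose g S : R := if [disjoint S & T] then 1 else
  if (z \in S) && (d \in S) then 0 else 2^-1.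
have disT S u : u \in S -> u \in T -> [disjoint S & T] = false.
  by move=> uS uT; apply/negbTE/pred0Pn; exists u; rewrite /= uS.
have [||w [w0 w1 wv we]] := lift g.
- by rewrite /g disjoints_subset sub0set.
- move=> e eF.
  pose B b := if (z \in e) && (d \in e) then ~: T :|: [set (if b then z else d)]
              else if b then setT else ~: T.
  exists (atoms (fun=> 2^-1) B).
  split=> [A|S Se]; first by apply: atoms_ge0 => _; rewrite invr_ge0.
  rewrite moment_atoms big_mkcond big_bool /B /g /=.
  have [/andP[ze de]|nzd] := boolP ((z \in e) && (d \in e)); last first.
    rewrite subsetT disjoints_subset [(z \in S) && _]negbTE.
      by case: ifP => _; lra.
    by apply: contraNN nzd => /andP[zS dS]; rewrite !(subsetP Se).
  have SB u v : [set u; v] = [set z; d] -> u != v ->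
      (S \subset ~: T :|: [set u]) = (v \notin S).
    move=> uvE uv; have vzd : v \in [set z; d] by rewrite -uvE !inE eqxx orbT.
    apply/idP/idP => [SB|vS].
      apply/negP => /(subsetP SB); rewrite in_setU in_setC in_set1.
      by rewrite [v == u]eq_sym (negbTE uv) orbF; case/set2P: vzd => ->; apply/negP/negPn.
    apply/subsetP => t tS; rewrite in_setU in_setC; have [tT|//] := boolP (t \in T).
    have := eT e t eF ze de (subsetP Se t tS) tT; rewrite -in_set2 -uvE !inE /=.
    by case/orP=> // /eqP tv; rewrite -tv tS in vS.
  rewrite (SB z d) // (SB d z) 1?eq_sym 1?setUC //.
  have -> : [disjoint S & T] = (z \notin S) && (d \notin S).
    apply/idP/andP => [dis|[zS dS]].
      by split; apply/negP => /disT; rewrite dis; [move/(_ zT)|move/(_ dT)].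
    rewrite disjoints_subset; apply/subsetP => t tS; rewrite inE.
    apply/negP => /(eT e t eF ze de (subsetP Se t tS)) /orP[]/eqP tE.
      by rewrite -tE tS in zS.
    by rewrite -tE tS in dS.
  by case: (z \in S); case: (d \in S) => /=; lra.
have g1 u : u \in T -> g [set u] = 2^-1.
  move=> uT; rewrite /g (disT _ u) ?set11 // !in_set1.
  by case: eqP => // <-; rewrite eq_sym (negbTE zNd).
(* Here [[set u]] and [e] both have moment 1/2, so [moment_supp] spreads membership over the whole
   edge. *)
have step A e u v : w A != 0 -> e \in F -> u \in e -> v \in e -> u \in T ->
    ~~ ((z \in e) && (d \in e)) -> u \in A -> v \in A.
  move=> wA eF ue ve uT nzd uA; apply: (subsetP _ v ve).
  apply: (@moment_supp _ _ w [set u]); rewrite ?sub1set //.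
  by rewrite -wv -we // g1 // /g (disT _ u) // (negbTE nzd).
have [A [wA xA]] : exists A, w A != 0 /\ x \in A.
  apply/not_existsP => noA; have : moment w [set x] = 0.
    apply: big1 => A; rewrite sub1set => xA; apply/eqP/negPn/negP => wA.
    exact: (noA A).
  by rewrite -wv g1 ?CT // => /eqP; rewrite invr_eq0 pnatr_eq0.
(* An edge meeting [C] avoids [d], so [step] applies to it. *)
have Cstep a c : c \in C \/ a \in C -> a \in T -> a \in A -> adj F a c -> c \in A.
  move=> acC aT aA /adjP[e [eF ae ce]].
  apply: (step A e a c) => //; apply/negP => /andP[_ de].
  by case: acC => [/Cd|/Cd] /adjP; apply; exists e.
have CA : C \subset A.
  apply: conC => // a c aA aC cC; apply: Cstep => //; first by left.
  exact: CT.
have yA : y \in A.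
  by apply: (Cstep cy y) => //; [right | apply: CT | apply: (subsetP CA)].
have zA : z \in A.
  by apply: (Cstep cz z) => //; [right | apply: CT | apply: (subsetP CA)].
have dA : d \in A.
  have /adjP[e [eF ye de]] := yd; apply: (step A e y d) => //.
  by apply/negP => /andP[ze _]; case/adjP: yz; exists e.
(* Membership has spread from [x] to [z] and [d], and nodes outside [T] are almost surely present;
   so [A] contains [e], although [e] has moment 0. *)
have /adjP[e [eF ze de]] := zd.
have : moment w e = 0 by rewrite -we // /g (disT _ z) // ze de.
move/(moment_eq0 w0)/(_ wA)/negP; apply; apply/subsetP => u ue.
have [uT|uT] := boolP (u \in T).
  by case/orP: (eT e u eF ze de ue uT) => /eqP->.
rewrite -sub1set; apply: (moment_supp w0 (sub0set _)) (sub0set _) => //.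
rewrite w1 -wv /g ifT // disjoints_subset sub1set inE; exact: uT.
Qed.

End Lifting.

(** * The polytopes in terms of moments *)

Section Relaxation.
Variables (R : realType) (V : finType).
Implicit Types (F : {set {set V}}) (G : hypergraph V) (S U e : {set V}).

Definition index_set F (i : coords F) : {set V} :=
  match i with inl v => [set v] | inr f => val f end.

Lemma index_set_incl G (i : coords (edges G)) :
  index_set (coords_incl i) = index_set i.
Proof. by case: i. Qed.

Lemma zval0 F (z : {ffun coords F -> R^o}) : zval z set0 = 1.
Proof. by rewrite /zval eqxx. Qed.

Lemma zval_index_set F (z : {ffun coords F -> R^o}) (i : coords F) :
  (forall f, f \in F -> (1 < #|f|)%N) -> zval z (index_set i) = z i.
Proof.
move=> F1; case: i => [v|f] /=; rewrite /zval.
  by rewrite -cards_eq0 cards1 set1K.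
have f1 := F1 _ (valP f); rewrite -cards_eq0 unset1N1; last by rewrite gtn_eqF.
by rewrite valK; case: #|_| f1.
Qed.

Lemma cl_gt1 F f : f \in cl F -> (1 < #|f|)%N.
Proof. by rewrite inE => /andP[]. Qed.

(** Inside an edge, every set with at least two elements belongs to [cl F], so the dummy value of
    [zval] never occurs. *)
Lemma zval_ffun F (g : {set V} -> R) S e : g set0 = 1 -> e \in F -> S \subset e ->
  zval ([ffun i => g (index_set i)] : {ffun coords (cl F) -> R^o}) S = g S.
Proof.
move=> g0 eF Se; rewrite /zval; have [->|SN0] := eqVneq S set0; first by rewrite g0.
have [/cards1P[v ->]|S1] := boolP (#|S| == 1%N); first by rewrite set1K ffunE.
rewrite unset1N1 //; have Scl : S \in cl F.
  rewrite inE ltn_neqAle eq_sym S1 card_gt0 SN0.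
  by apply/existsP; exists e; rewrite eF.
by rewrite insubT ffunE.
Qed.

Lemma psi_mobius F (z : {ffun coords F -> R^o}) U e : U \subset e ->
  psi z U e = mobius (zval z) e (e :\: U).
Proof.
move=> Ue; rewrite /mobius setDDr setDv set0U (setIidPr Ue).
rewrite [RHS](bigID (fun W : {set V} => odd #|W|)) /= addrC /psi.
rewrite -sumrN; congr (_ + _); apply: eq_bigr => W /andP[_ oW].
  by rewrite -signr_odd (negbTE oW) mul1r.
by rewrite -signr_odd oW expr1 mulN1r.
Qed.

Lemma sub_max_edge G e : e \in edges G ->
  exists2 m, m \in max_edges G & e \subset m.
Proof.
move=> eE; have [m mmax em] := @maxset_exists _ (mem (edges G)) e eE.
have mE : m \in edges G := maxsetp mmax.
exists m => //; rewrite inE mE /=.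
apply/forall_inP => f fE; apply/implyP => mf.
by rewrite (maxsetsup mmax fE mf).
Qed.

(** On a maximal edge [m] the numbers psi(m \ A, m) serve as the weights of the sets [A]; smaller
    edges inherit this measure. *)
Lemma CERP G (z : {ffun coords (cl (edges G)) -> R^o}) :
  CER R G z <-> forall e, e \in edges G ->
    exists w : {set V} -> R, (forall A, 0 <= w A) /\
      forall S, S \subset e -> zval z S = moment w S.
Proof.
split=> [zC e eE|loc e].
  have [m mmax em] := sub_max_edge eE.
  exists (fun A : {set V} => if A \subset m then mobius (zval z) m A else 0); split=> [A|S Se].
    case: ifP => // Am; have := zC m mmax (m :\: A) (subsetDl _ _).
    by rewrite psi_mobius ?subsetDl // setDDr setDv set0U (setIidPr Am).
  by rewrite moment_mobius // (subset_trans Se).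
rewrite inE => /andP[eE _] U Ue; have [w [w0 wz]] := loc e eE.
rewrite psi_mobius //; suff -> : mobius (zval z) e (e :\: U) = fibre w e (e :\: U).
  exact: sumr_ge0.
rewrite fibre_moment ?subsetDl //; apply: eq_bigr => W We.
by rewrite wz // subUset subsetDl (subset_trans We) // subsetDl.
Qed.

Lemma prod_indicator (I : finType) (B A : {set I}) :
  \prod_(i in B) (i \in A)%:R = (B \subset A)%:R :> R.
Proof.
have [/subsetP BA|/subsetPn[x xB xA]] := boolP (B \subset A).
  by apply: big1 => i /BA ->.
by rewrite (bigD1 x) //= (negbTE xA) mul0r.
Qed.

(** A vertex is the indicator of containment in its set of ones, so convex weights on vertices
    amount to a probability measure on sets. *)
Lemma MPP G (z : {ffun coords (edges G) -> R^o}) :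
  MP R G z <-> exists w : {set V} -> R, [/\ forall A, 0 <= w A,
    moment w set0 = 1 & forall i, z i = moment w (index_set i)].
Proof.
split=> [[n [p [a [pV a0 a1 ->]]]]|[w [w0 w1 wz]]].
  pose B k := [set v | p k (inl v) == 1].
  have pB k v : p k (inl v) = (v \in B k)%:R.
    by rewrite inE; have [/(_ (inl v))[->|->] _] := pV k; rewrite ?eqxx // eq_sym oner_eq0.
  exists (atoms a B); split=> [A||i]; first exact: atoms_ge0.
    by rewrite moment_atoms (eq_bigl xpredT) // => k; rewrite sub0set.
  rewrite moment_atoms sum_ffunE [RHS]big_mkcond; apply: eq_bigr => k _.
  rewrite ffunE; have -> : p k i = (index_set i \subset B k)%:R.
    case: i => [v|e] /=; first by rewrite sub1set pB.
    have [_ ->] := pV k; rewrite -prod_indicator.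
    by apply: eq_bigr => v _; rewrite pB.
  by case: ifP => _; [exact: mulr1 | exact: mulr0].
exists #|{set V}|.
pose B (k : 'I_#|{set V}|) : {set V} := enum_val k.
exists (fun k => [ffun i => (index_set i \subset B k)%:R]).
exists (fun k => w (B k)); split=> [k|k||]; last first.
- apply/ffunP => i; rewrite sum_ffunE wz /moment.
  rewrite big_mkcond (reindex _ (onW_bij _ (@enum_val_bij {set V}))) /=.
  apply: eq_bigr => k _; rewrite !ffunE.
  by case: ifP => _; [rewrite [RHS]mulr1 | rewrite [RHS]mulr0].
- by rewrite -w1 moment0 (reindex _ (onW_bij _ (@enum_val_bij {set V}))).
- exact: w0.
- split=> [i|e]; rewrite !ffunE.
    by case: (_ \subset _); [right | left].
  by rewrite -prod_indicator; apply: eq_bigr => v _; rewrite ffunE /= sub1set.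
Qed.

Lemma extension_lifting G :
  is_extension (@coords_incl V G) (CER R G) (MP R G) <-> lifting R (edges G).
Proof.
split=> [ext g g0 loc|lift].
  pose z : {ffun coords (cl (edges G)) -> R^o} := [ffun i => g (index_set i)].
  have zE i : proj (@coords_incl V G) z i = g (index_set i).
    by rewrite !ffunE index_set_incl.
  have : MP R G (proj (@coords_incl V G) z).
    rewrite ext; exists z => //; apply/CERP => e eE.
    have [w [w0 wg]] := loc e eE; exists w; split=> // S Se.
    by rewrite (zval_ffun g0 eE) // wg.
  move=> /MPP[w [w0 w1 wz]]; exists w; split=> // [v|e eE].
    by rewrite -(wz (inl v)) zE.
  by rewrite -(wz (inr (exist _ e eE))) zE.
apply/seteqP; split=> [z /MPP[w [w0 w1 wz]]|_ [z /CERP zC <-]].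
  (* This inclusion needs no lifting: a global measure supplies the additional coordinates as its
     own moments. *)
  exists [ffun i => moment w (index_set i)].
    apply/CERP => e eE; exists w; split=> // S Se.
    exact: (zval_ffun w1 eE).
  by apply/ffunP => i; rewrite !ffunE index_set_incl wz.
have [w [w0 w1 wv we]] := lift _ (zval0 z) zC.
apply/MPP; exists w; split=> // i.
rewrite ffunE -(zval_index_set z _ (@cl_gt1 _)) index_set_incl.
by case: i => [v|e]; [exact: wv | exact: we (valP e)].
Qed.

End Relaxation.

Theorem theorem2 (R : realType) (V : finType) (G : hypergraph V)
    (Hcover : forall v : V, exists2 e : {set V}, e \in edges G & v \in e) :
  is_extension (@coords_incl V G) (CER R G) (MP R G) <-> alpha_acyclic G.
Proof.
rewrite extension_lifting; split=> [lift|[s sE rs]].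
  have cho := lifting_chordal lift; have conf := lifting_conformal Hcover lift.
  exact: chordal_conformal_rip.
exact: (rip_lifting Hcover sE rs).
Qed.
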